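(* Let $F$ be a finite field with $|F|=q$, and let $V$ be a vector space over $F$ with $\dim(V)=n$. If $n$ is even, then $$\sum_{i=1}^{\frac{n}{2}-1} \begin{bmatrix} n \\ i \end{bmatrix}_{q}+\begin{bmatrix} n-1 \\ \frac{n-2}{2} \end{bmatrix}_{q}\;\leq\; w(G(V))\;\leq\; \sum_{i=1}^{\frac{n}{2}-1} \begin{bmatrix} n \\ i \end{bmatrix}_{q}+\begin{bmatrix} n \\ \frac{n}{2} \end{bmatrix}_{q}-q^{\frac{n^2}{4}}-1.$$
   Context: For a finite-dimensional vector space $V$ over a finite field, the intersection graph of subspaces $G(V)$ is the simple graph whose vertices are the proper nontrivial subspaces of $V$ (i.e. subspaces $W$ with $W\neq 0$ and $W\neq V$), two distinct vertices being adjacent if and only if the corresponding subspaces have nonzero intersection. The clique number $w(G)$ of a graph $G$ is the maximum size of a set of pairwise adjacent vertices of $G$. For an integer $m\geq 1$ and $t\in\{1,\dots,m\}$, $\begin{bmatrix} m \\ t \end{bmatrix}_{q}=\prod_{0\leq i<t}\frac{q^{m-i}-1}{q^{t-i}-1}$ is the number of $t$-dimensional subspaces of an $m$-dimensional vector space over the field with $q$ elements; also $\begin{bmatrix} m \\ 0 \end{bmatrix}_{q}=1$ and $\begin{bmatrix} m \\ t \end{bmatrix}_{q}=0$ if $t\notin\{0,1,\dots,m\}$.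
   Formalization: The upper bound is stated only for even n ≥ 4, since for n = 2 it reads w(G(V)) = 1 ≤ 0 and for n = 0 it reads 0 ≤ −1; the case n = 0, where the binomial with upper index n−1 is undefined, is excluded, and the lower bound is kept for all even n ≥ 2. *)

(* Defs.v *)
From HB Require Import structures.
From mathcomp Require Import all_boot all_order all_algebra.
Set Implicit Arguments.
Unset Strict Implicit.
Unset Printing Implicit Defensive.
Import Order.TTheory GRing.Theory Num.Theory.
Local Open Scope ring_scope.

Definition is_clique (T : finType) (e : rel T) (A : {set T}) : bool :=
  [forall x in A, forall y in A, (x != y) ==> e x y].

Definition clique_number (T : finType) (e : rel T) : nat :=
  \max_(A : {set T} | is_clique e A) #|A|.

Section FiniteSubspaces.
Import VectorInternalTheory.
Variables (F : finFieldType) (vT : vectType F).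
HB.instance Definition _ := [Finite of {vspace vT} by <:].
End FiniteSubspaces.

Definition proper_nontrivial (F : fieldType) (vT : vectType F)
    (W : {vspace vT}) : bool :=
  (W != 0%VS) && (W != fullv).

Definition intersection_graph (F : fieldType) (vT : vectType F) :
    rel {W : {vspace vT} | proper_nontrivial W} :=
  fun U W => (U != W) && ((sval U :&: sval W)%VS != 0%VS).
Arguments intersection_graph {F} vT.

(* The Gaussian binomial takes values in rat, so that the divisions here and
   any subtraction between such values are genuine rather than truncated. *)
Definition gauss_binom (q m t : nat) : rat :=
  if (t <= m)%N then
    \prod_(0 <= i < t) ((q%:R ^+ (m - i) - 1) / (q%:R ^+ (t - i) - 1))
  else 0.

(* Main.v *)
Require Import Defs.
From mathcomp Require Import all_boot all_order all_algebra.
From mathcomp Require Import finfield.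
From mathcomp Require Import zify ring.
Set Implicit Arguments.
Unset Strict Implicit.
Unset Printing Implicit Defensive.
Import Order.TTheory GRing.Theory Num.Theory.
Local Open Scope ring_scope.

(** Write n = 2k. A clique is a family of proper nontrivial subspaces any two
    of which meet nontrivially.

    Lower bound: take all proper subspaces of dimension greater than k together
    with the k-dimensional subspaces through a fixed nonzero vector v. Two of
    these meet, either because their dimensions add up to more than n or because
    both contain v. There are [n, i] subspaces of dimension n - i, and
    [n-1, k-1] subspaces of dimension k through v
    ([card_subspaces_through]).

    Upper bound: for i < k, being complementary is a bipartite relation between
    dimension i and dimension n - i that is regular of the same degree
    q^(i(n-i)) on both sides, and a clique contains no complementary pair.
    Double counting then leaves at most [n, i] members of the clique in these
    two dimensions together ([card_no_complementary_pair]). In dimension k, one member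
    W excludes its q^(k^2) complements, and one further subspace is lost because,
    as k > 1, the k-dimensional subspaces that meet W include two disjoint ones
    ([card_middle]).

    Everything rests on one enumeration, the number of t-dimensional subspaces
    that meet a given W trivially ([card_disjoint_subspaces]): it yields the
    Gaussian binomials for W = 0, the number of complements when
    dim W = n - t, and, by subtraction, the number of subspaces through a line
    when dim W = 1. *)

(** * Arithmetic of Gaussian binomials *)

Section GaussianBinomials.
Variable q : nat.
Hypothesis q_gt1 : (1 < q)%N.
Local Notation Q := (q%:R : rat).

Lemma subX_neq0 a b : (a < b)%N -> Q ^+ b - Q ^+ a != 0.
Proof. by move=> ab; rewrite subr_eq0 gt_eqF // ltr_eXn2l // ltr1n. Qed.

Lemma subX1_neq0 a : (0 < a)%N -> Q ^+ a - 1 != 0.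
Proof. exact: (@subX_neq0 0). Qed.

Lemma subXE a i : (i <= a)%N -> Q ^+ a - Q ^+ i = Q ^+ i * (Q ^+ (a - i) - 1).
Proof. by move=> ia; rewrite mulrBr mulr1 -exprD subnKC. Qed.

Lemma div_subX a b i : (i <= a)%N -> (i <= b)%N ->
  (Q ^+ a - Q ^+ i) / (Q ^+ b - Q ^+ i) = (Q ^+ (a - i) - 1) / (Q ^+ (b - i) - 1).
Proof.
move=> ia ib; rewrite !subXE // -mulf_div divff ?mul1r //.
by rewrite expf_neq0 // pnatr_eq0; lia.
Qed.

Lemma gauss_binomE m t : (t <= m)%N ->
  gauss_binom q m t = \prod_(0 <= i < t) ((Q ^+ m - Q ^+ i) / (Q ^+ t - Q ^+ i)).
Proof.
move=> tm; rewrite /gauss_binom tm; apply: eq_big_nat => i /andP[_ it].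
by rewrite div_subX //; lia.
Qed.

(** This is the q-Pascal rule: the product is q^(t+1) [m, t+1], the number of
    (t+1)-dimensional subspaces of an (m+1)-dimensional space that avoid a line,
    so the right-hand side counts those that contain it. *)
Lemma gauss_binom_sub_avoiding m t : (t <= m)%N ->
  gauss_binom q m.+1 t.+1
    - \prod_(0 <= i < t.+1) ((Q ^+ m.+1 - Q ^+ (1 + i)) / (Q ^+ t.+1 - Q ^+ i))
  = gauss_binom q m t.
Proof.
move=> tm; rewrite /gauss_binom ltnS tm.
set P := \prod_(0 <= i < t) _.
have -> : \prod_(0 <= i < t.+1) ((Q ^+ (m.+1 - i) - 1) / (Q ^+ (t.+1 - i) - 1))
    = (Q ^+ m.+1 - 1) / (Q ^+ t.+1 - 1) * P.
  by rewrite big_nat_recl.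
rewrite (eq_big_nat _ _
    (F2 := fun i => Q * ((Q ^+ (m - i) - 1) / (Q ^+ (t.+1 - i) - 1)))); last first.
  move=> i /andP[_ it].
  by rewrite add1n (exprS _ m) (exprS _ i) -mulrBr -mulrA div_subX //; lia.
rewrite big_split prodr_const_nat subn0 /= prodf_div big_nat_recr //=.
rewrite (big_nat_recl _ _ (fun i => Q ^+ (t.+1 - i) - 1)) //= subn0.
rewrite /P prodf_div.
have D_neq0 : \prod_(0 <= i < t) (Q ^+ (t - i) - 1) != 0.
  rewrite big_nat prodf_seq_neq0; apply/allP => i _; apply/implyP => /andP[_ it].
  by rewrite subX1_neq0 // subn_gt0.
have x_neq1 := @subX1_neq0 t.+1 isT.
have -> : Q ^+ m.+1 = Q ^+ t.+1 * Q ^+ (m - t) by rewrite -exprD addSn subnKC.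
move: D_neq0 x_neq1; set D := (X in X != 0 -> _).
rewrite (_ : \prod_(0 <= i < t) (Q ^+ (t.+1 - i.+1) - 1) = D) //.
move: (Q ^+ t.+1) (Q ^+ (m - t)) D (\prod_(0 <= i < t) _) => x y D N D_neq0 x_neq1.
by field; rewrite D_neq0 x_neq1.
Qed.
End GaussianBinomials.

(** * Counting subspaces disjoint from a given one *)

Section Counting.
Variables (F : finFieldType) (V : vectType F).
Local Notation q := (#|F|%:R : rat).
Local Notation fV := (finvect_type V).
Local Notation n := (\dim {: V}).
Local Notation subspaces t := [set U : {vspace V} | \dim U == t].

Let q_gt1 : (1 < #|F|)%N := finNzRing_gt1 F.

(** The vectors of X are chosen one at a time, each outside the span of s and of
    those chosen before. The carrier is [finvect_type V] since tuples of vectors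
    are counted, which needs a finite type. *)
Lemma card_free_tuples (U : {vspace fV}) (s : seq fV) (t : nat) :
    free s -> {subset s <= U} ->
  #|[set X : t.-tuple fV | all (mem U) X && free (X ++ s)]|%:R
    = \prod_(0 <= i < t) (q ^+ \dim U - q ^+ (size s + i)).
Proof.
move=> s_free sU; elim: t => [|t IHt].
  rewrite big_geq // (_ : [set _ | _] = [set [tuple]]) ?cards1 //.
  by apply/setP => X; rewrite [X]tuple0 !inE eqxx.
rewrite big_nat_recr //= -IHt; set T := [set X : t.-tuple fV | _ && _].
rewrite -[in LHS]sum1_card natr_sum.
pose glue (p : t.-tuple fV * fV) : t.+1.-tuple fV := cons_tuple p.2 p.1.
rewrite (reindex glue) /=; last first.
  exists (fun X : t.+1.-tuple fV => ([tuple of behead X], thead X)) => [[X v] _|X _] /=.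
    by congr (_, _); apply: val_inj.
  by rewrite [RHS]tuple_eta; apply: val_inj.
pose new (X : t.-tuple fV) : pred fV := [predD U & <<X ++ s>>%VS].
rewrite (eq_bigl (fun p => (p.1 \in T) && (p.2 \in new p.1))); last first.
  case=> X v; rewrite !inE /= free_cons.
  by case: (v \in U); case: (v \in _); rewrite /= ?andbF ?andbT.
rewrite -(pair_big_dep (fun X => X \in T) (fun X v => v \in new X)
  (fun _ _ => 1%:R)) /= -sum1_card natr_sum big_distrl.
apply: eq_bigr => X; rewrite inE => /andP[XU X_free].
rewrite [RHS]mul1r -natr_sum sum1_card.
have spanU : (<<X ++ s>> <= U)%VS.
  by apply/span_subvP => v; rewrite mem_cat => /orP[/(allP XU)|/sU].
have := cardID (mem <<X ++ s>>%VS) (mem U).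
rewrite (_ : #|predI _ _| = #|<<X ++ s>>%VS|); last first.
  by apply: eq_card => v; rewrite !inE andbC; apply/andb_idr/(subvP spanU).
rewrite !card_vspace (eqP X_free) size_cat size_tuple addnC.
move=> /(congr1 (fun c => c%:R : rat)); rewrite natrD !natrX addnC => <-.
by rewrite addrK.
Qed.

(** The tuples X with X ++ vbasis W free are the bases of the subspaces U with
    dim U = t and U :&: W = 0; each such U has as many of them as there are free
    t-tuples in U, which is the denominator. *)
Lemma card_disjoint_subspaces_fin (W : {vspace fV}) t :
  #|[set U : {vspace fV} | (\dim U == t) && (U :&: W == 0)%VS]|%:R
    = \prod_(0 <= i < t)
        ((q ^+ \dim {: fV} - q ^+ (\dim W + i)) / (q ^+ t - q ^+ i)).
Proof.
set S := [set U | _].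
have w_basis : basis_of W (vbasis W) := vbasisP W.
have wW : <<vbasis W>>%VS = W := span_basis w_basis.
have := card_free_tuples t (basis_free w_basis) (fun v _ => memvf v).
rewrite size_tuple => cardT.
rewrite prodf_div -cardT.
set T := [set X : t.-tuple fV | _ && _].
have den_neq0 : \prod_(0 <= i < t) (q ^+ t - q ^+ i) != 0.
  rewrite big_nat prodf_seq_neq0; apply/allP => i _; apply/implyP => it.
  by case/andP: it => _; apply: subX_neq0.
apply/(canRL (mulfK den_neq0)).
rewrite -[in RHS]sum1_card.
rewrite (partition_big (fun X : t.-tuple fV => <<X>>%VS) (mem S)) /=; last first.
  move=> X; rewrite !inE cat_free => /and3P[_ X_free /andP[_ /directv_addP]].
  by rewrite (eqP X_free) size_tuple eqxx /= => <-; rewrite wW.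
rewrite natr_sum -sum1_card natr_sum big_distrl; apply: eq_bigr => U /=.
rewrite inE => /andP[/eqP dimU /eqP UW]; rewrite mul1r.
have nil_sub : {subset [::] <= U} by [].
have := card_free_tuples t (nil_free _) nil_sub.
rewrite dimU => <-; rewrite sum1_card; congr _%:R.
(* the tuples of the family that span U are the free tuples inside U *)
apply: eq_card => X; rewrite [RHS]unfold_in /= !inE cats0.
apply/andP/andP => [[/allP XU X_free]|[/andP[_]]].
  have spanX : <<X>>%VS = U.
    apply/eqP; rewrite eqEdim (eqP X_free) size_tuple dimU leqnn andbT.
    by apply/span_subvP.
  rewrite spanX eqxx cat_free X_free (basis_free w_basis) spanX wW /=.
  split=> //; apply/andP; split; last exact/directv_addP.
  by apply/allP => v _; apply: memvf.
rewrite cat_free => /andP[X_free _] /eqP spanX; split=> //.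
by apply/allP => v vX; rewrite /= -spanX memv_span.
Qed.

Lemma card_disjoint_subspaces (W : {vspace V}) (t : nat) :
  #|[set U : {vspace V} | (\dim U == t) && (U :&: W == 0)%VS]|%:R
    = \prod_(0 <= i < t)
        ((q ^+ \dim {: V} - q ^+ (\dim W + i)) / (q ^+ t - q ^+ i)).
Proof.
(* [finvect_type V] and V become convertible once the record V is destructed *)
have fin W' := card_disjoint_subspaces_fin W' t.
by case: V W fin => T c W; exact.
Qed.

Lemma card_subspaces t : (t <= n)%N -> #|subspaces t|%:R = gauss_binom #|F| n t.
Proof.
move=> tn; rewrite gauss_binomE //.
have := card_disjoint_subspaces 0%VS t; rewrite dimv0 => <-.
by congr _%:R; apply: eq_card => U; rewrite !inE capv0 eqxx andbT.
Qed.

(** Each factor of the product collapses to q^(dim W). *)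
Lemma card_complements (W : {vspace V}) t : (\dim W + t)%N = n ->
  #|[set U : {vspace V} | (\dim U == t) && (U :&: W == 0)%VS]|
    = (#|F| ^ (\dim W * t))%N.
Proof.
move=> Wt; apply/eqP; rewrite -(eqr_nat rat) card_disjoint_subspaces -Wt natrX.
rewrite (eq_big_nat _ _ (F2 := fun=> q ^+ \dim W)); last first.
  by move=> i /andP[_ it]; rewrite !exprD -mulrBr mulfK // subX_neq0.
by rewrite prodr_const_nat subn0 exprM.
Qed.

Lemma cap_line_eq0 (U : {vspace V}) (v : V) : v != 0 ->
  ((U :&: <[v]>)%VS == 0%VS) = (v \notin U).
Proof.
move=> v_neq0; rewrite -subv0; apply/idP/idP.
  apply: contraL => vU; apply/negP => /subvP/(_ v).
  by rewrite memv_cap vU memv_line memv0 (negPf v_neq0) => /(_ isT).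
move=> vU; apply/subvP => x /memv_capP[xU /vlineP[a def_x]].
move: xU; rewrite {}def_x; have [->|a_neq0] := eqVneq a 0.
  by rewrite scale0r !mem0v.
by rewrite rpredZeq (negPf a_neq0) (negPf vU).
Qed.

(** The subspaces that avoid the line spanned by v are counted by
    [card_disjoint_subspaces]; those through v are the others. *)
Lemma card_subspaces_through (v : V) t : v != 0 -> (0 < t <= n)%N ->
  #|[set U : {vspace V} | (\dim U == t) && (v \in U)]|%:R
    = gauss_binom #|F| n.-1 t.-1.
Proof.
move=> v_neq0 /andP[t_gt0 tn].
pose avoid := [set U : {vspace V} | (\dim U == t) && (U :&: <[v]> == 0)%VS].
have split_card : (#|subspaces t|%:R : rat) =
    #|[set U : {vspace V} | (\dim U == t) && (v \in U)]|%:R + #|avoid|%:R.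
  rewrite -natrD -(cardsID [set U : {vspace V} | v \in U]).
  congr (_ + _)%:R; apply: eq_card => U; rewrite !inE //.
  by rewrite andbC cap_line_eq0.
move: split_card; rewrite card_subspaces // card_disjoint_subspaces dim_vline v_neq0.
move=> /(canLR (addrK _)) <-.
case: t t_gt0 tn {avoid} => // t _; case: n => // m tm.
exact: gauss_binom_sub_avoiding.
Qed.

(** * Families without complementary pairs *)

(** Complementarity is a bipartite relation between dimensions i and j in which
    every subspace has q^(i j) partners. The partners of P avoid Q, so the pairs
    counted from P number at most those counted from the complement of Q. *)
Lemma card_no_complementary_pair i j (P Q : {set {vspace V}}) : (i + j)%N = n ->
    P \subset subspaces i -> Q \subset subspaces j ->
    {in P & Q, forall U W, (U :&: W)%VS != 0%VS} ->
  (#|P| + #|Q| <= #|subspaces j|)%N.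
Proof.
move=> ij /subsetP Pi /subsetP Qj PQ.
have d_gt0 : (0 < #|F| ^ (i * j))%N by rewrite expn_gt0 (ltnW (finNzRing_gt1 F)).
rewrite addnC -leq_subRL ?subset_leq_card //; last exact/subsetP.
rewrite -(setIidPr (introT subsetP Qj)) -cardsD.
rewrite -(leq_pmul2r d_gt0) -!sum_nat_const.
pose D (U W : {vspace V}) := (U :&: W)%VS == 0%VS.
have dimP U : U \in P -> \dim U = i by move=> /Pi; rewrite inE => /eqP.
have dimQ W : W \in subspaces j :\: Q -> \dim W = j by rewrite !inE => /andP[_ /eqP].
rewrite (eq_bigr (fun U => \sum_(W in subspaces j :\: Q | D W U) 1)%N); last first.
  move=> U UP; have Uj : (\dim U + j)%N = n by rewrite dimP.
  rewrite -{1}(dimP U UP) -(card_complements Uj) sum1_card.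
  apply: eq_card => W; rewrite [RHS]unfold_in /= !inE -/(D _ _).
  case DWU: (D W U); rewrite ?andbF // !andbT.
  apply/esym/andb_idl => _; apply/negP => WQ; move: (PQ U W UP WQ).
  by rewrite capvC -/(D W U) DWU.
rewrite (exchange_big_dep (mem (subspaces j :\: Q))) /=; last by move=> U W _ /andP[].
apply: leq_sum => W WQ; have Wi : (\dim W + i)%N = n by rewrite dimQ // addnC.
have := card_complements Wi; rewrite (dimQ W WQ) mulnC => <-.
rewrite sum1_card; apply/subset_leq_card/subsetP => U; rewrite unfold_in /= !inE.
by move=> /andP[UP /andP[_ DWU]]; rewrite dimP // eqxx capvC.
Qed.

(** With one of the two families empty and the other full, the previous bound
    gives both inequalities. *)
Lemma card_subspaces_sym i j : (i + j)%N = n -> #|subspaces i| = #|subspaces j|.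
Proof.
move=> ij; apply/eqP; rewrite eqn_leq.
have le_card a b : (a + b)%N = n -> (#|subspaces a| <= #|subspaces b|)%N.
  move=> ab; have := card_no_complementary_pair ab (subxx _) (sub0set (subspaces b)).
  by rewrite cards0 addn0; apply=> U W _; rewrite inE.
by rewrite !le_card // addnC.
Qed.

(** * The middle dimension *)

Lemma complement_through (L X : {vspace V}) : (X :&: L = 0)%VS ->
  exists2 Y : {vspace V}, (L <= Y)%VS & (X :&: Y = 0)%VS /\ (\dim X + \dim Y)%N = n.
Proof.
move=> XL; exists (L + (X + L)^C)%VS; first exact: addvSl.
have sumV : (X + (L + (X + L)^C))%VS = fullv by rewrite addvA addv_complf.
have dimXY : (\dim X + \dim (L + (X + L)^C) <= n)%N.
  have := (dimv_add_leqif L (X + L)^C)%VS.1; rewrite dimv_compl (dimv_disjoint_sum XL).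
  have := dimvS (subvf (X + L)%VS); rewrite (dimv_disjoint_sum XL).
  by lia.
have := dimv_sum_cap X (L + (X + L)^C)%VS; rewrite sumV => dim_sum.
split; last by lia.
by apply/eqP; rewrite -dimv_eq0; lia.
Qed.

Lemma exists_dim t : (t <= n)%N -> exists U : {vspace V}, \dim U = t.
Proof.
move=> tn; exists <<take t (vbasis {:V})>>%VS.
have := basis_free (vbasisP {:V}); rewrite -{1}(cat_take_drop t (vbasis _)).
by move=> /catl_free/eqP ->; rewrite size_take size_tuple; case: ltngtP tn.
Qed.

(** For L a line of W and T' a hyperplane of a complement of W, the subspace
    X = L + T' meets W exactly in L. As k > 1, some w in W lies outside X, and a
    complement of X through w is the required Y. *)
Lemma disjoint_pair_meeting k (W : {vspace V}) : (1 < k)%N -> n = k.*2 ->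
    \dim W = k ->
  exists X Y : {vspace V}, [/\ \dim X = k, \dim Y = k, (X :&: Y = 0)%VS,
    (X :&: W != 0)%VS & (Y :&: W != 0)%VS].
Proof.
move=> k_gt1 n2k dimW.
have [T _ [WT dimT]] := complement_through (capv0 W).
have lineP (U : {vspace V}) : \dim U = k ->
    (<[vpick U]> <= U)%VS /\ \dim <[vpick U]> = 1%N.
  move=> dimU; rewrite -memvE memv_pick dim_vline vpick0 -dimv_eq0 dimU.
  by split=> //; case: k k_gt1 {n2k dimW dimU}.
have [L_W dimL] := lineP W dimW.
have [M_T dimM] := lineP T ltac:(lia).
set L := <[vpick W]>%VS in L_W dimL *; set M := <[vpick T]>%VS in M_T dimM.
have T'_T := diffvSl T M; have := dimv_cap_compl T M; rewrite (capv_idPr M_T).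
set T' := (T :\: M)%VS in T'_T * => dimT'.
have WT' : (W :&: T' = 0)%VS by apply/eqP; rewrite -subv0 -WT capvS.
have LT' : (L :&: T' = 0)%VS by apply/eqP; rewrite -subv0 -WT' capvS.
have XW : ((L + T') :&: W)%VS = L by rewrite -vspace_modl // capvC WT' addv0.
have dimX : \dim (L + T') = k by rewrite dimv_disjoint_sum //; lia.
have /subvPn[w wW wX] : ~~ (W <= L + T')%VS.
  by apply/negP => /capv_idPr; rewrite XW => LW; move: dimL; rewrite LW dimW; lia.
have w_neq0 : w != 0 by apply: contraNneq wX => ->; apply: mem0v.
have Xw : ((L + T') :&: <[w]> = 0)%VS by apply/eqP; rewrite cap_line_eq0.
have [Y wY [XY dimXY]] := complement_through Xw.
exists (L + T')%VS, Y; split=> //; first by lia.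
  by rewrite XW -dimv_eq0 dimL.
apply/eqP => YW0; move: w_neq0; rewrite -memv0 -YW0 memv_cap wW andbT.
by rewrite memvE wY.
Qed.

(** If W is in B, or if B is empty and W is arbitrary, then B lies in the set of
    the k-dimensional subspaces that are not complements of W. The inclusion is
    strict because that set contains two disjoint subspaces. *)
Lemma card_middle k (B : {set {vspace V}}) : (1 < k)%N -> n = k.*2 ->
    B \subset subspaces k -> {in B &, forall U W, (U :&: W)%VS != 0%VS} ->
  (#|B| + #|F| ^ (k * k) + 1 <= #|subspaces k|)%N.
Proof.
move=> k_gt1 n2k /subsetP Bk BB.
have dimB U : U \in B -> \dim U = k by move=> /Bk; rewrite inE => /eqP.
have [W dimW BW] : exists2 W : {vspace V},
    \dim W = k & {in B, forall U, (U :&: W)%VS != 0%VS}.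
  have [->|[W WB]] := set_0Vmem B.
    by have [|W dimW] := @exists_dim k; [lia|exists W => // U; rewrite inE].
  by exists W; [exact: dimB|move=> U UB; exact: BB].
have [X [Y [dimX dimY XY XW YW]]] := disjoint_pair_meeting k_gt1 n2k dimW.
rewrite -{1}dimW -(@card_complements W); last by rewrite dimW n2k addnn.
rewrite -(cardsID [set U : {vspace V} | (U :&: W == 0)%VS] (subspaces k)).
rewrite -setIdE addn1 addnC.
rewrite (_ : [set U in subspaces k | _] =
    [set U | (\dim U == k) && (U :&: W == 0)%VS]); last first.
  by apply/setP => U; rewrite !inE.
rewrite ltn_add2l; apply/proper_card/properP; split.
  by apply/subsetP => U UB; rewrite !inE BW ?dimB ?eqxx.
have XR : X \in subspaces k :\: [set U : {vspace V} | (U :&: W == 0)%VS].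
  by rewrite !inE dimX eqxx XW.
have YR : Y \in subspaces k :\: [set U : {vspace V} | (U :&: W == 0)%VS].
  by rewrite !inE dimY eqxx YW.
have [XB|XB] := boolP (X \in B); last by exists X.
exists Y => //; apply/negP => YB; move: (BB X Y XB YB).
by rewrite XY eqxx.
Qed.

(** * Cliques as intersecting families of subspaces *)

(** The diagonal case U = W is included: it costs nothing, as members are
    nonzero, and spares the distinctness side condition of cliques. *)
Definition intersecting (B : {set {vspace V}}) :=
  {in B, forall U, proper_nontrivial U} /\ {in B &, forall U W, (U :&: W)%VS != 0%VS}.

Lemma clique_intersecting A : is_clique (intersection_graph V) A ->
  exists2 B, intersecting B & #|B| = #|A|.
Proof.
move=> /forall_inP clA; exists [set val x | x in A].
  2: by rewrite card_imset //; apply: val_inj.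
split=> [_ /imsetP[x _ ->]|_ _ /imsetP[x xA ->] /imsetP[y yA ->]]; first exact: valP.
have [<-|xy] := eqVneq x y.
  by rewrite capvv; have /andP[] := valP x.
by have /forall_inP/(_ y yA) := clA x xA; rewrite xy => /andP[].
Qed.

Lemma intersecting_le_clique B : intersecting B ->
  (#|B| <= clique_number (intersection_graph V))%N.
Proof.
move=> [Bpn BB]; pose A := [set x : {W : {vspace V} | proper_nontrivial W} | val x \in B].
have -> : #|B| = #|A|.
  rewrite -[RHS](card_imset _ val_inj); apply: eq_card => U; apply/idP/imsetP.
    by move=> UB; exists (exist _ U (Bpn U UB)); rewrite ?inE.
  by case=> x; rewrite inE => xB ->.
apply: (leq_bigmax_cond (F := fun A : {set _} => #|A|)); apply/forall_inP => x; rewrite inE => xB.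
apply/forall_inP => y; rewrite inE => yB; apply/implyP => xy.
by rewrite /intersection_graph xy BB.
Qed.

Lemma proper_nontrivialE (U : {vspace V}) : proper_nontrivial U = (0 < \dim U < n)%N.
Proof.
rewrite /proper_nontrivial lt0n dimv_eq0; congr (_ && _).
by rewrite ltn_neqAle dimvS ?subvf // andbT (dimv_leqif_eq (subvf U)).2.
Qed.

Lemma sum_card_dim (B : {set {vspace V}}) : {in B, forall U, proper_nontrivial U} ->
  #|B| = (\sum_(1 <= i < n) #|B :&: subspaces i|)%N.
Proof.
move=> Bpn; rewrite -sum1_card.
under [RHS]eq_bigr do rewrite -sum1_card big_mkcond /=.
rewrite exchange_big /= big_mkcond; apply: eq_bigr => U _.
have [UB|UB] := boolP (U \in B); last by rewrite big1 // => i _; rewrite !inE (negPf UB).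
have := Bpn U UB; rewrite proper_nontrivialE => dimU.
under eq_bigr do rewrite !inE UB /= eq_sym.
by rewrite -big_mkcond big_nat1_eq dimU.
Qed.
End Counting.

(** Pairs the dimensions i and 2k - i, which is how the clique is bounded. *)
Lemma sum_fold_middle (f : nat -> nat) k : (0 < k)%N ->
  (\sum_(1 <= i < k.*2) f i = \sum_(1 <= i < k) (f i + f (k.*2 - i)) + f k)%N.
Proof.
move=> k_gt0; rewrite (@big_cat_nat _ _ _ k) //=; last by lia.
rewrite big_split /= -addnA; congr (_ + _)%N.
rewrite big_ltn; last by lia.
rewrite addnC; congr (_ + _)%N.
rewrite [RHS]big_nat_rev -[k.+1 in LHS]add1n big_addn (_ : k.*2 - k = k)%N; last by lia.
rewrite [RHS]big_nat [LHS]big_nat; apply: eq_bigr => i ik.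
by congr f; lia.
Qed.

Theorem theorem9 (F : finFieldType) (V : vectType F) (q n : nat)
    (hq : #|F| = q) (hn : \dim (fullv : {vspace V}) = n)
    (n_gt0 : (0 < n)%N) (n_even : ~~ odd n) :
  \sum_(1 <= i < n./2) gauss_binom q n i + gauss_binom q n.-1 (n - 2)./2
    <= (clique_number (intersection_graph V))%:R
  /\ ((2 < n)%N ->
      (clique_number (intersection_graph V))%:R
        <= \sum_(1 <= i < n./2) gauss_binom q n i + gauss_binom q n n./2
           - q%:R ^+ (n ^ 2 %/ 4) - 1).
Proof.
subst q; set k := n./2.
have n2k : n = k.*2 by rewrite even_halfK.
have k_gt0 : (0 < k)%N by lia.
have dimV : \dim {:V} = k.*2 by rewrite hn.
have -> : (n - 2)./2 = k.-1 by lia.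
have -> : (n ^ 2 %/ 4 = k * k)%N.
  by rewrite n2k -muln2 expnMn mulnK // -mulnn.
pose N t := #|[set U : {vspace V} | \dim U == t]|.
have gaussN t : (t <= n)%N -> gauss_binom #|F| n t = (N t)%:R.
  by move=> tn; rewrite -hn -card_subspaces // hn.
rewrite (eq_big_nat _ _ (F2 := fun i => (N i)%:R)); last first.
  by move=> i ik; apply: gaussN; lia.
rewrite -natr_sum gaussN; last by lia.
split=> [|n_gt2].
  have [v _ v_neq0] : exists2 v : V, v \in fullv & v != 0.
    exists (vpick {:V}); first exact: memvf.
    by rewrite vpick0 -dimv_eq0 hn; lia.
  rewrite -hn -(card_subspaces_through v_neq0) ?hn; last by lia.
  rewrite -natrD ler_nat.
  pose B := [set U : {vspace V} | (k < \dim U < n)%N ||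
    (\dim U == k) && (v \in U)].
  apply: leq_trans (@intersecting_le_clique _ _ B _).
    rewrite (@sum_card_dim _ _ B); last first.
      by move=> U; rewrite inE proper_nontrivialE hn; lia.
    rewrite dimV sum_fold_middle // leq_add //; last first.
      by apply/subset_leq_card/subsetP => U; rewrite !inE => /andP[-> ->]; rewrite orbT.
    rewrite big_nat [leqRHS]big_nat; apply: leq_sum => i ik.
    rewrite /N (@card_subspaces_sym _ _ i (k.*2 - i)) ?dimV; last by lia.
    apply: leq_trans (leq_addl _ _); apply/subset_leq_card/subsetP => U.
    by rewrite !inE => /eqP ->; lia.
  split=> [U|U W]; first by rewrite inE proper_nontrivialE hn; lia.
  rewrite !inE => UB WB; apply/eqP => UW.
  (* disjoint members would have dim U + dim W <= 2k, hence both dimension k *)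
  have := dimvS (subvf (U + W)); rewrite dimv_disjoint_sum // hn.
  move=> dimUW; have [/andP[_ vU] /andP[_ vW]] :
     ((\dim U == k) && (v \in U)) /\ ((\dim W == k) && (v \in W)) by lia.
  by move: v_neq0; rewrite -memv0 -UW memv_cap vU vW.
rewrite -addrA -opprD lerBrDr -natrX -[1]/(1%:R) -!natrD ler_nat.
have [A clA ->] : exists2 A, is_clique (intersection_graph V) A &
    clique_number (intersection_graph V) = #|A|.
  have cl0 : is_clique (intersection_graph V) set0.
    by apply/forall_inP => x; rewrite inE.
  by rewrite /clique_number (bigop.bigmax_eq_arg _ cl0); case: arg_maxnP => // A; exists A.
have [B [Bpn BB] <-] := clique_intersecting clA.
rewrite (@sum_card_dim _ _ B) // dimV sum_fold_middle // -addnA leq_add //.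
  rewrite big_nat [leqRHS]big_nat; apply: leq_sum => i ik.
  rewrite /N (@card_subspaces_sym _ _ i (k.*2 - i)) ?dimV; last by lia.
  apply: (@card_no_complementary_pair _ _ i (k.*2 - i)); rewrite ?subsetIr ?hn //; first by lia.
  by move=> U W /setIP[UB _] /setIP[WB _]; apply: BB.
rewrite addnA; apply: card_middle; rewrite ?subsetIr //; first by lia.
by move=> U W /setIP[UB _] /setIP[WB _]; apply: BB.
Qed.
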